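(* Let $b_{gt}=[z_0^{gt},z_1^{gt},z_2^{gt},z_3^{gt}]\in\mathcal{B}$ be a ground-truth bounding box with $a(b_{gt})>0$. For $i=0,1,2,3$ let $[\underline{z_i},\overline{z_i}]\subset\mathbb{R}_{+}$ be a nonempty closed interval, and assume $\underline{z_0}\le\underline{z_2}$, $\overline{z_0}\le\overline{z_2}$, $\underline{z_1}\le\underline{z_3}$, $\overline{z_1}\le\overline{z_3}$. Let $[\underline{\mathbf b},\overline{\mathbf b}]=\{[z_0,z_1,z_2,z_3]\in\mathcal{B} : \underline{z_i}\le z_i\le\overline{z_i},\ i=0,\dots,3\}$. Define $b_u^*=[z_0^*,z_1^*,z_2^*,z_3^*]$ by $$z_i^*=\begin{cases} z_i^{gt} & \text{if } z_i^{gt}\in[\underline{z_i},\overline{z_i}],\\ \underline{z_i} & \text{if } z_i^{gt}\le\underline{z_i},\\ \overline{z_i} & \text{otherwise.}\end{cases}$$ Then $$\max_{b\in[\underline{\mathbf b},\overline{\mathbf b}]} IoU_{gt}(b)=IoU_{gt}(b_u^* ).$$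
   Context: The set of bounding boxes is $\mathcal{B}=\{[z_0,z_1,z_2,z_3]\in\mathbb{R}_{+}^4 : z_0\le z_2,\ z_1\le z_3\}$, where $\mathbb{R}_{+}=[0,\infty)$; $(z_0,z_1)$ is the bottom-left corner and $(z_2,z_3)$ the upper-right corner. The area of a box $b=[z_0,z_1,z_2,z_3]\in\mathcal{B}$ is $a(b)=(z_2-z_0)(z_3-z_1)$. The intersection of $b$ with the ground truth $b_{gt}$ is $$i_{gt}(b)=\big[\max(z_0,z_0^{gt}),\max(z_1,z_1^{gt}),\min(z_2,z_2^{gt}),\min(z_3,z_3^{gt})\big],$$ and its area $a(i_{gt}(b))$ is given by the same formula when $i_{gt}(b)\in\mathcal{B}$ and is taken to be $0$ when $i_{gt}(b)\notin\mathcal{B}$ (the boxes do not overlap). The Intersection over Union is $$IoU_{gt}(b)=\frac{a(i_{gt}(b))}{a(b_{gt})+a(b)-a(i_{gt}(b))}\in[0,1].$$ *)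

(* Defs.v *)
From HB Require Import structures.
From mathcomp Require Import all_boot all_order all_algebra.
From mathcomp Require Import classical_sets reals.

Set Implicit Arguments.
Unset Strict Implicit.
Unset Printing Implicit Defensive.

Import Order.TTheory GRing.Theory Num.Theory.

Local Open Scope classical_set_scope.
Local Open Scope ring_scope.

(* A point [z_0, z_1, z_2, z_3] of R^4 is a row vector z, with z_i = z 0 i;    *)
(* the column indices 0, 1, 2, 3 below are numerals of the ring 'I_4.          *)

Definition row4 (R : realType) (x0 x1 x2 x3 : R) : 'rV[R]_4 :=
  \row_(i < 4) [:: x0; x1; x2; x3]`_i.

Definition bbox (R : realType) : {pred 'rV[R]_4} :=
  [pred b : 'rV[R]_4 |
    [&& [forall i, 0 <= b 0 i], b 0 0 <= b 0 2 & b 0 1 <= b 0 3]].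
Arguments bbox {R}.

(* Only meaningful on bbox: outside it the product may be negative, or even    *)
(* positive when both side lengths are negative.                               *)
Definition area (R : realType) (b : 'rV[R]_4) : R :=
  (b 0 2 - b 0 0) * (b 0 3 - b 0 1).

Definition inter (R : realType) (gt b : 'rV[R]_4) : 'rV[R]_4 :=
  row4 (Num.max (b 0 0) (gt 0 0)) (Num.max (b 0 1) (gt 0 1))
       (Num.min (b 0 2) (gt 0 2)) (Num.min (b 0 3) (gt 0 3)).

Definition inter_area (R : realType) (gt b : 'rV[R]_4) : R :=
  if inter gt b \in bbox then area (inter gt b) else 0.

Definition IoU (R : realType) (gt b : 'rV[R]_4) : R :=
  inter_area gt b / (area gt + area b - inter_area gt b).

Definition box_range (R : realType) (lo hi : 'rV[R]_4) : set 'rV[R]_4 :=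
  [set b | b \in bbox /\ forall i, lo 0 i <= b 0 i <= hi 0 i].

Definition bstar (R : realType) (gt lo hi : 'rV[R]_4) : 'rV[R]_4 :=
  \row_i (if lo 0 i <= gt 0 i <= hi 0 i then gt 0 i
          else if gt 0 i <= lo 0 i then lo 0 i
          else hi 0 i).

Definition is_max (R : realType) (A : set R) (m : R) : Prop :=
  A m /\ ubound A m.

(* Main.v *)
(** Write w1, w2 for the side lengths of b and c1, c2 for those of its overlap
    with gt.  Cross-multiplied, IoU(b) <= IoU(b* ) reads
      c1 c2 (a(gt) + w1* w2* ) <= c1* c2* (a(gt) + w1 w2).
    On each axis, moving an endpoint to the point of its range closest to that
    of gt can only increase the overlap c and decrease the excess w - c, so
    c <= c* and c w* <= c* w; multiplying over the two axes gives the claim. *)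

Require Import Defs.
From HB Require Import structures.
From mathcomp Require Import all_boot all_order all_algebra.
From mathcomp Require Import classical_sets reals.
From mathcomp Require Import lra.

Set Implicit Arguments.
Unset Strict Implicit.
Unset Printing Implicit Defensive.

Import Order.TTheory GRing.Theory Num.Theory.

Local Open Scope classical_set_scope.
Local Open Scope ring_scope.

Section Clamp.
Variable R : realFieldType.
Implicit Types g h l u p q : R.

Definition clamp g l u : R :=
  if l <= g <= u then g else if g <= l then l else u.

Lemma clampP g l u : l <= u ->
  [\/ clamp g l u = g /\ l <= g <= u,
      clamp g l u = l /\ g <= l | clamp g l u = u /\ u <= g].
Proof.
move=> lu; rewrite /clamp; case: ifPn => [H|]; first by apply: Or31.
case: (leP g l) => [gl _|lg]; first by apply: Or32.
by rewrite (ltW lg) /= -ltNge => /ltW ug; apply: Or33.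
Qed.

Lemma clamp_itv g l u : l <= u -> l <= clamp g l u <= u.
Proof. by move=> lu; case: (clampP g lu) => -[-> H]; lra. Qed.

(** Monotonicity in all three arguments keeps the corners of [bstar] in order; this is where the
    ordering of the ranges of opposite sides enters. *)
Lemma le_clamp g h l u l' u' : l <= u -> l' <= u' ->
  g <= h -> l <= l' -> u <= u' -> clamp g l u <= clamp h l' u'.
Proof.
move=> lu lu' gh ll uu.
by case: (clampP g lu) => -[-> H]; case: (clampP h lu') => -[-> H']; lra.
Qed.

(** [Num.max p g - p] is the length by which an interval starting at [p] protrudes to the left of
    [g]. The nearest point to [g] minimises it without giving up any overlap. *)
Lemma clamp_max g l u p : l <= p <= u ->
  Num.max (clamp g l u) g <= Num.max p g /\
  Num.max (clamp g l u) g - clamp g l u <= Num.max p g - p.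
Proof.
move=> /andP[lp pu]; case: (clampP g (le_trans lp pu)) => -[-> H];
  by split; do 2 case: (leP _ g) => ?; lra.
Qed.

Lemma clamp_min g l u p : l <= p <= u ->
  Num.min p g <= Num.min (clamp g l u) g /\
  clamp g l u - Num.min (clamp g l u) g <= p - Num.min p g.
Proof.
move=> /andP[lp pu]; case: (clampP g (le_trans lp pu)) => -[-> H];
  by split; do 2 case: (leP _ g) => ?; lra.
Qed.

(** Signed, not truncated at 0: a negative value means that the intervals are disjoint. *)
Definition overlap g h p q : R := Num.min q h - Num.max p g.

Lemma overlap_le g h p q : overlap g h p q <= q - p.
Proof. by rewrite /overlap; case: (leP q h) => ?; case: (leP p g) => ?; lra. Qed.

Lemma overlap_clamp g h l u l' u' p q : l <= p <= u -> l' <= q <= u' ->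
  overlap g h p q <= overlap g h (clamp g l u) (clamp h l' u').
Proof.
move=> /(clamp_max g)[H1 _] /(clamp_min h)[H2 _].
by rewrite /overlap lerB.
Qed.

(** Split each width into overlap plus excess: the product of the two overlaps cancels, leaving
    [c * (w' - c') <= c' * (w - c)]. This passes through [c * (w - c)], using [0 <= c] and then
    [0 <= w - c]. *)
Lemma overlap_clamp_ratio g h l u l' u' p q : l <= p <= u -> l' <= q <= u' ->
  0 <= overlap g h p q ->
  overlap g h p q * (clamp h l' u' - clamp g l u) <=
  overlap g h (clamp g l u) (clamp h l' u') * (q - p).
Proof.
move=> Hp Hq c0; have cc := overlap_clamp g h Hp Hq.
have w0 := overlap_le g h p q.
have [_ H1] := clamp_max g Hp; have [_ H2] := clamp_min h Hq.
set c := overlap g h p q in c0 cc w0 *.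
set c' := overlap g h (clamp g l u) (clamp h l' u') in cc *.
set w := q - p in w0 *; set w' := clamp h l' u' - clamp g l u.
have ee : w' - c' <= w - c by rewrite /c /c' /w /w' /overlap; lra.
have h1 : c * (w' - c') <= c * (w - c) by rewrite ler_wpM2l.
have h2 : c * (w - c) <= c' * (w - c) by rewrite ler_wpM2r // subr_ge0.
lra.
Qed.

End Clamp.

Lemma bboxP (R : realType) (b : 'rV[R]_4) :
  reflect [/\ forall i, 0 <= b 0 i, b 0 0 <= b 0 2 & b 0 1 <= b 0 3]
          (b \in bbox).
Proof. by apply: (iffP and3P) => -[/forallP]. Qed.

Lemma bstarE (R : realType) (gt lo hi : 'rV[R]_4) i :
  bstar gt lo hi 0 i = clamp (gt 0 i) (lo 0 i) (hi 0 i).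
Proof. by rewrite mxE. Qed.

Section Overlap.
Variables (R : realType) (gt : 'rV[R]_4).
Hypothesis gt_box : gt \in bbox.

Definition overlap_x (b : 'rV[R]_4) := overlap (gt 0 0) (gt 0 2) (b 0 0) (b 0 2).
Definition overlap_y (b : 'rV[R]_4) := overlap (gt 0 1) (gt 0 3) (b 0 1) (b 0 3).

(** Coordinates of the intersection inherit nonnegativity from [gt] and [b], so only the two side
    lengths decide membership in [bbox]. Both signs are tested because two negative overlaps have a
    nonnegative product. *)
Lemma inter_areaE b : b \in bbox ->
  inter_area gt b = if (0 <= overlap_x b) && (0 <= overlap_y b)
                    then overlap_x b * overlap_y b else 0.
Proof.
have /bboxP[g0 _ _] := gt_box; move=> /bboxP[b0 _ _].
rewrite /inter_area /area !mxE /=; congr (if _ then _ else _).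
rewrite /overlap_x /overlap_y /overlap !subr_ge0.
apply/bboxP/andP => [[_]|[H1 H2]]; rewrite ?mxE //=; split; rewrite ?mxE //.
by case=> [[|[|[|[|]]]]] //= ?; rewrite mxE /= ?le_max ?le_min ?b0 ?g0.
Qed.

Lemma inter_area_ge0 b : b \in bbox -> 0 <= inter_area gt b.
Proof.
by move=> /inter_areaE ->; case: ifP => // /andP[? ?]; rewrite mulr_ge0.
Qed.

Lemma inter_area_le b : b \in bbox -> inter_area gt b <= area b.
Proof.
move=> bb; have /bboxP[_ b02 b13] := bb; rewrite inter_areaE //.
case: ifP => [/andP[? ?]|_]; last by rewrite mulr_ge0 ?subr_ge0.
by rewrite ler_pM ?overlap_le.
Qed.

End Overlap.

Lemma bstar_bbox (R : realType) (gt lo hi : 'rV[R]_4) :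
  gt \in bbox -> (forall i, 0 <= lo 0 i) -> (forall i, lo 0 i <= hi 0 i) ->
  lo 0 0 <= lo 0 2 -> hi 0 0 <= hi 0 2 ->
  lo 0 1 <= lo 0 3 -> hi 0 1 <= hi 0 3 -> bstar gt lo hi \in bbox.
Proof.
move=> /bboxP[_ g02 g13] lo_ge0 lo_hi *; apply/bboxP.
split; rewrite ?bstarE ?le_clamp // => i; rewrite bstarE.
by have /andP[/(le_trans (lo_ge0 i))] := clamp_itv (gt 0 i) (lo_hi i).
Qed.

Lemma inter_area_bstar (R : realType) (gt lo hi b : 'rV[R]_4) :
  gt \in bbox -> 0 <= area gt -> bstar gt lo hi \in bbox ->
  b \in box_range lo hi ->
  inter_area gt b * (area gt + area (bstar gt lo hi)) <=
  inter_area gt (bstar gt lo hi) * (area gt + area b).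
Proof.
move=> gtb G0 sb; rewrite inE => -[bb b_in].
have /bboxP[_ b02 b13] := bb; have /bboxP[_ s02 s13] := sb.
rewrite [X in X * _](inter_areaE gtb bb); case: ifP => [/andP[cx cy]|_]; last first.
  by rewrite mul0r mulr_ge0 ?inter_area_ge0 ?addr_ge0 // mulr_ge0 ?subr_ge0.
have cx_le := overlap_clamp (gt 0 0) (gt 0 2) (b_in 0) (b_in 2).
have cy_le := overlap_clamp (gt 0 1) (gt 0 3) (b_in 1) (b_in 3).
have rx := overlap_clamp_ratio (b_in 0) (b_in 2) cx.
have ry := overlap_clamp_ratio (b_in 1) (b_in 3) cy.
rewrite -!bstarE -/(overlap_x gt _) in cx_le rx.
rewrite -!bstarE -/(overlap_y gt _) in cy_le ry.
rewrite inter_areaE // (le_trans cx cx_le) (le_trans cy cy_le) /=.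
(* The [area gt] terms compare by the growth of the overlaps; the remaining terms, regrouped by
   axis, are the product of [rx] and [ry]. *)
rewrite !(mulrDr _ (area gt)) lerD //; first by rewrite ler_wpM2r // ler_pM.
rewrite /area mulrACA [leRHS]mulrACA.
by apply: ler_pM => //; apply: mulr_ge0 => //; rewrite subr_ge0.
Qed.

Theorem mainTheorem1 (R : realType) (gt lo hi : 'rV[R]_4)
  (gt_box : gt \in bbox) (gt_area : 0 < area gt)
  (lo_ge0 : forall i, 0 <= lo 0 i) (lo_le_hi : forall i, lo 0 i <= hi 0 i)
  (lo02 : lo 0 0 <= lo 0 2) (hi02 : hi 0 0 <= hi 0 2)
  (lo13 : lo 0 1 <= lo 0 3) (hi13 : hi 0 1 <= hi 0 3) :
  bstar gt lo hi \in bbox /\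
  is_max [set IoU gt b | b in box_range lo hi] (IoU gt (bstar gt lo hi)).
Proof.
have sb := bstar_bbox gt_box lo_ge0 lo_le_hi lo02 hi02 lo13 hi13.
(* The intersection is no larger than [b], so the denominator is at least [area gt]. *)
have den_gt0 b : b \in bbox -> 0 < area gt + area b - inter_area gt b.
  by move=> bb; rewrite -addrA ltr_wpDr // subr_ge0 inter_area_le.
split=> //; split.
  by exists (bstar gt lo hi) => //; split=> // i; rewrite bstarE clamp_itv.
move=> _ [b [bb b_in] <-]; rewrite /IoU.
rewrite ler_pdivrMr ?den_gt0 // mulrAC ler_pdivlMr ?den_gt0 //.
(* After cross-multiplication both sides subtract the product of the two intersection areas, which
   cancels. *)
rewrite !(mulrBr _ (area gt + _)) [X in _ <= _ - X]mulrC lerD2r.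
by apply: inter_area_bstar; rewrite ?inE // ltW.
Qed.
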